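(* Let $k\ge1$ and consider the DD-phys strategy on $k$ physical (unencoded) qubits with decoupling group $\tilde G=\tilde{\mathcal P}_k$, physical error probability $p\in[0,1)$ and suppression parameter $p_{\rm DD}\in[0,1]$. With no DD (i.e. $p_{\rm DD}=1$), the probability of no error is $F_{\rm DD}=(1-p)^k$. With DD, the probability of no error is $$F_{\rm DD}=\frac{(1-p)^k}{(1-p)^k+p_{\rm DD}\bigl[1-(1-p)^k\bigr]}=1-k\,p\,p_{\rm DD}+O(p^2)$$ as $p\to0$, uniformly in $p_{\rm DD}$.
   Context: $\tilde{\mathcal P}_k$ is the $k$-qubit Pauli group modulo phases; its elements are strings $E'\in\{I,X,Y,Z\}^k$, with weight $\mathrm{wt}(E')$ the number of non-identity letters. Error model: without DD, $E'$ occurs with probability $(1-p)^{k-\mathrm{wt}(E')}(p/3)^{\mathrm{wt}(E')}$. With DD using $\tilde G$, the probabilities of all $E'$ that anticommute (as Pauli operators) with at least one element of $\tilde G$ are multiplied by $p_{\rm DD}$, and then all probabilities are renormalized to sum to $1$. In DD-phys there is no encoding or recovery, $\tilde G=\tilde{\mathcal P}_k$ (so every non-identity $E'$ is suppressed), and $F_{\rm DD}$ is the probability that $E'$ is the identity. *)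

(* Defs.v *)
From HB Require Import structures.
From mathcomp Require Import all_boot all_order all_algebra.
From mathcomp Require Import complex mxtens.
From mathcomp Require Import all_classical all_reals all_analysis.

Set Implicit Arguments.
Unset Strict Implicit.
Unset Printing Implicit Defensive.

Import Order.TTheory GRing.Theory Num.Theory.
Import numFieldNormedType.Exports.

Local Open Scope ring_scope.

Inductive pauli : Type := PI | PX | PY | PZ.

Definition pauli_code (a : pauli) : bool * bool :=
  match a with
  | PI => (false, false)
  | PX => (true, false)
  | PY => (true, true)
  | PZ => (false, true)
  end.

Definition pauli_decode (c : bool * bool) : pauli :=
  match c with
  | (false, false) => PI
  | (true, false) => PX
  | (true, true) => PY
  | (false, true) => PZ
  end.

Lemma pauli_codeK : cancel pauli_code pauli_decode.
Proof. by case. Qed.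

HB.instance Definition _ := Finite.copy pauli (can_type pauli_codeK).

(* The k-qubit Pauli group modulo phases, each class being represented by its
   unique phase-free string. Only the elements of this group matter below, not
   its product. *)
Notation pauli_string k := (k.-tuple pauli).

Definition pauli_id (k : nat) : pauli_string k := [tuple of nseq k PI].

Definition pauli_wt (k : nat) (E : pauli_string k) : nat :=
  count (predC1 PI) E.

Definition pauli_mx (R : realType) (a : pauli) : 'M[R[i]]_2 :=
  match a with
  | PI => 1%:M
  | PX => \matrix_(r, c) (if r == c then 0 else 1)
  | PY => \matrix_(r, c) (if r == c then 0 else if r == 0 then - 'i%C else 'i%C)
  | PZ => \matrix_(r, c) (if r == c then if r == 0 then 1 else - 1 else 0)
  end.

(* The dimension 2 ^ k, in a form for which 2 * qdim k is convertible to
   qdim k.+1 (which fails for expn). *)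
Fixpoint qdim (k : nat) : nat := if k is k'.+1 then (2 * qdim k')%N else 1%N.

Fixpoint pauli_op (R : realType) (k : nat) : pauli_string k -> 'M[R[i]]_(qdim k) :=
  match k return pauli_string k -> 'M[R[i]]_(qdim k) with
  | 0 => fun _ => 1%:M
  | k'.+1 => fun E => pauli_mx R (thead E) *t pauli_op R (behead_tuple E)
  end.

Definition anticommute (R : realType) (k : nat) (E F : pauli_string k) : bool :=
  pauli_op R E *m pauli_op R F == - (pauli_op R F *m pauli_op R E).

Definition err_prob (R : realType) (k : nat) (p : R) (E : pauli_string k) : R :=
  (1 - p) ^+ (k - pauli_wt E) * (p / 3) ^+ pauli_wt E.

Definition dd_weight (R : realType) (k : nat) (G : {set pauli_string k})
    (p pDD : R) (E : pauli_string k) : R :=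
  (if [exists g in G, anticommute R E g] then pDD else 1) * err_prob p E.

Definition dd_prob (R : realType) (k : nat) (G : {set pauli_string k})
    (p pDD : R) (E : pauli_string k) : R :=
  dd_weight G p pDD E / \sum_(E' : pauli_string k) dd_weight G p pDD E'.

(* DD-phys: no encoding and no recovery, so that the only harmless error is the
   identity, and the decoupling group is the whole Pauli group. *)
Definition F_DD (R : realType) (k : nat) (p pDD : R) : R :=
  dd_prob [set: pauli_string k] p pDD (pauli_id k).

(* Main.v *)
(* Every non-identity Pauli string anticommutes with some Pauli string, because
   this already holds for one non-identity letter, whereas the identity
   anticommutes with none since Pauli operators are nonzero. Hence only the
   identity escapes suppression, and as the error probabilities add up to 1,
   normalization yields the formula for F_DD. Writing q = (1 - p)^k, x = k p and
   D = q + d (1 - q), one has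
     q / D - (1 - x d) = d (x - (1 - q)) - d (1 - d) (1 - q)^2 / D,
   where 0 <= x - (1 - q) <= x^2, 0 <= 1 - q <= x, and D >= 1/2 once x <= 1/2;
   so the error is at most 3 x^2, uniformly in d. *)
Require Import Defs.
From mathcomp Require Import all_boot all_order all_algebra.
From mathcomp Require Import complex mxtens.
From mathcomp Require Import all_classical all_reals all_analysis.
From mathcomp Require Import ring lra.

Import Order.TTheory GRing.Theory Num.Theory.
Import numFieldNormedType.Exports.

Local Open Scope ring_scope.

(** * Pauli operators and their anticommutation *)

Lemma tens1mx1 (R : comPzRingType) (m n : nat) :
  (1%:M : 'M[R]_m) *t (1%:M : 'M[R]_n) = 1%:M.
Proof.
apply/matrixP=> i j.
case: (mxtens_indexP i) => i0 i1; case: (mxtens_indexP j) => j0 j1.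
rewrite tensmxE !mxE -natrM mulnb (can_eq (@mxtens_indexK _ _)).
by rewrite -pair_eqE.
Qed.

Lemma pauli_mx_sq (R : realType) (a : pauli) :
  pauli_mx R a *m pauli_mx R a = 1%:M.
Proof.
case: a => /=; first exact: mulmx1.
all: apply/matrixP=> i j; rewrite !mxE big_ord_recl big_ord1 !mxE.
all: case: i => [[|[|//]] ?]; case: j => [[|[|//]] ?].
all: rewrite /= ?(mulr0, mul0r, addr0, add0r, mulr1, mulrN, mulNr, opprK) //.
all: by rewrite -expr2 sqr_i opprK.
Qed.

(** Distinct non-identity letters anticommute, so any letter other than [a] and [PI] can serve as
    witness. *)
Lemma pauli_mx_anticommuting (R : realType) (a : pauli) : a != PI ->
  exists b, pauli_mx R a *m pauli_mx R b = - (pauli_mx R b *m pauli_mx R a).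
Proof.
case: a => // _; [exists PZ | exists PZ | exists PX].
all: apply/matrixP=> i j; rewrite !mxE !big_ord_recl !big_ord0 !mxE.
all: case: i => [[|[|//]] ?]; case: j => [[|[|//]] ?].
all: rewrite /= ?(mulr0, mul0r, addr0, add0r, mulr1, mul1r,
  mulrN, mulNr, opprK, oppr0) //.
Qed.

Lemma pauli_op_id (R : realType) (k : nat) : pauli_op R (pauli_id k) = 1%:M.
Proof.
elim: k => [//|k IH] /=.
have -> : behead_tuple (pauli_id k.+1) = pauli_id k by apply: val_inj.
by rewrite IH tens1mx1.
Qed.

Lemma pauli_op_cons (R : realType) (k : nat) (a : pauli) (E : pauli_string k) :
  pauli_op R [tuple of a :: E] = pauli_mx R a *t pauli_op R E.
Proof. by rewrite /= theadE; congr (_ *t pauli_op R _); apply: val_inj. Qed.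

(** Serves to show that Pauli operators do not vanish: the square of 0 is not the identity in
    positive dimension. *)
Lemma pauli_op_sq (R : realType) (k : nat) (E : pauli_string k) :
  pauli_op R E *m pauli_op R E = 1%:M.
Proof.
elim: k E => [|k IH] E /=; first exact: mulmx1.
by rewrite tensmx_mul pauli_mx_sq IH tens1mx1.
Qed.

Lemma qdim_gt0 (k : nat) : (0 < qdim k)%N.
Proof. by elim: k => //= k IH; rewrite muln_gt0. Qed.

Lemma pauli_op_neq0 (R : realType) (k : nat) (E : pauli_string k) :
  pauli_op R E != 0.
Proof.
apply/eqP=> E0; have := pauli_op_sq R k E; rewrite E0 mul0mx => /matrixP.
move/(_ (Ordinal (qdim_gt0 k)) (Ordinal (qdim_gt0 k))).
by rewrite !mxE eqxx => /eqP; rewrite eq_sym oner_eq0.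
Qed.

(** Anticommuting with the identity would force twice the operator of [E] to be 0. *)
Lemma anticommute_id (R : realType) (k : nat) (E : pauli_string k) :
  anticommute R (pauli_id k) E = false.
Proof.
apply/negbTE; rewrite /anticommute pauli_op_id mul1mx mulmx1 -addr_eq0.
rewrite -mulr2n -scaler_nat scaler_eq0 pnatr_eq0 /=; exact: pauli_op_neq0.
Qed.

(** Induction on the length. A head [PI] is copied in front of the witness for the tail. Any other
    head is paired with an anticommuting letter and the tail is repeated: it commutes with itself,
    so the sign comes from the head alone. *)
Lemma exists_anticommute (R : realType) (k : nat) (E : pauli_string k) :
  E != pauli_id k -> exists F, anticommute R E F.
Proof.
rewrite /anticommute; elim: k E => [|k IH] E;
  first by rewrite tuple0 [pauli_id 0]tuple0 eqxx.
case/tupleP: E => a E neq1.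
have [aI|/(pauli_mx_anticommuting R) [b ab]] := eqVneq a PI.
  have /IH [F /eqP EF] : E != pauli_id k.
    by apply: contraNneq neq1 => ->; rewrite aI; apply/eqP/val_inj.
  exists [tuple of PI :: F]; apply/eqP.
  rewrite !pauli_op_cons aI !tensmx_mul EF.
  by apply/matrixP=> i j; rewrite !mxE mulrN.
exists [tuple of b :: E]; apply/eqP.
rewrite !pauli_op_cons !tensmx_mul ab.
by apply/matrixP=> i j; rewrite !mxE mulNr.
Qed.

(** * The error distribution without decoupling *)

Lemma card_pauli : #|{: pauli}| = 4.
Proof.
have -> : #|{: pauli}| = #|{: bool * bool}|.
  by apply: (@bij_eq_card _ _ pauli_code);
     exists pauli_decode => [|[[] []]] //; case.
by rewrite card_prod card_bool.
Qed.

Lemma err_probE (R : realType) (k : nat) (p : R) (E : pauli_string k) :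
  err_prob p E = \prod_(i < k) (if tnth E i == PI then 1 - p else p / 3).
Proof.
rewrite -(big_tuple _ _ E xpredT (fun a => if a == PI then 1 - p else p / 3)).
rewrite /err_prob /pauli_wt -{1}(size_tuple E).
elim: (tval E) => [|a s IH]; first by rewrite big_nil mulr1.
rewrite big_cons -IH /=; case: eqP => _ /=.
  by rewrite add0n subSn ?count_size // exprS mulrA.
by rewrite add1n subSS exprS mulrCA.
Qed.

(** The letters are independent, so the sum of products is a product of [k] sums, each equal to (1 -
    p) + 3 (p / 3) = 1. *)
Lemma sum_err_prob (R : realType) (k : nat) (p : R) :
  \sum_(E : pauli_string k) err_prob p E = 1.
Proof.
pose w a : R := if a == PI then 1 - p else p / 3.
have w1 : \sum_a w a = 1.
  rewrite (bigD1 PI) //= (eq_bigr (fun=> p / 3)); last first.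
    by move=> a; rewrite /w => /negbTE ->.
  by rewrite sumr_const cardC1 card_pauli /w eqxx -[_ *+ _]mulr_natr /=; field.
(* Strings are traded for finite functions, the form in which [bigA_distr_bigA] exchanges sum and
   product. *)
rewrite (reindex (fun f : {ffun 'I_k -> pauli} => [tuple f i | i < k])) /=.
  transitivity (\sum_(f : {ffun 'I_k -> pauli}) \prod_(i < k) w (f i)).
    apply: eq_bigr => f _; rewrite err_probE.
    by apply: eq_bigr => i _; rewrite tnth_mktuple.
  by rewrite -(bigA_distr_bigA (fun=> w)) big1.
exists (fun E => [ffun i => tnth E i]) => [f _|E _].
  by apply/ffunP=> i; rewrite ffunE tnth_mktuple.
by apply: eq_from_tnth => i; rewrite tnth_mktuple ffunE.
Qed.

Lemma err_prob_id (R : realType) (k : nat) (p : R) :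
  err_prob p (pauli_id k) = (1 - p) ^+ k.
Proof.
have -> : err_prob p (pauli_id k) = \prod_(i < k) (1 - p).
  by rewrite err_probE; apply: eq_bigr => i _; rewrite tnth_nseq eqxx.
by rewrite prodr_const card_ord.
Qed.

(** * Suppressed weights and the closed formula *)

Lemma dd_weight_id (R : realType) (k : nat) (G : {set pauli_string k})
    (p pDD : R) :
  dd_weight G p pDD (pauli_id k) = err_prob p (pauli_id k).
Proof.
rewrite /dd_weight; case: existsP => [[g]|_]; last by rewrite mul1r.
by rewrite anticommute_id andbF.
Qed.

Lemma dd_weight_neq_id (R : realType) (k : nat) (p pDD : R)
    (E : pauli_string k) : E != pauli_id k ->
  dd_weight [set: pauli_string k] p pDD E = pDD * err_prob p E.
Proof.
move=> /(exists_anticommute R k) [g Eg]; rewrite /dd_weight.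
by case: existsP => // -[]; exists g; rewrite inE.
Qed.

Lemma F_DDE (R : realType) (k : nat) (p pDD : R) :
  F_DD k p pDD = (1 - p) ^+ k / ((1 - p) ^+ k + pDD * (1 - (1 - p) ^+ k)).
Proof.
rewrite /F_DD /dd_prob (bigD1 (pauli_id k)) //= dd_weight_id err_prob_id.
congr (_ / (_ + _)).
rewrite (eq_bigr (fun E => pDD * err_prob p E)); last exact: dd_weight_neq_id.
rewrite -big_distrr /=; congr (_ * _).
have := sum_err_prob R k p; rewrite (bigD1 (pauli_id k)) //= err_prob_id.
by move/(canRL (addKr _)) ->; rewrite addrC.
Qed.

(** * First-order expansion, uniform in the suppression parameter *)

Lemma exprB1_bounds (R : realDomainType) (k : nat) (p : R) : 0 <= p <= 1 ->
  1 - k%:R * p <= (1 - p) ^+ k <= 1 - k%:R * p + (k%:R * p) ^+ 2.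
Proof.
move=> /andP[p0 p1]; elim: k => [|k /andP[IH1 IH2]].
  by rewrite expr0 !mul0r expr0n subr0 addr0 lexx.
have q0 : 0 <= 1 - p by rewrite subr_ge0.
have kp2 : 0 <= k%:R * p ^+ 2 by rewrite mulr_ge0 // exprn_ge0.
have kp3 : 0 <= (k%:R * p) ^+ 2 * p by rewrite mulr_ge0 // sqr_ge0.
have p2 : 0 <= p ^+ 2 by rewrite sqr_ge0.
rewrite exprS -natr1; apply/andP; split.
  apply: le_trans (ler_wpM2l q0 IH1); rewrite -subr_ge0.
  by apply: le_trans kp2 _; rewrite le_eqVlt; apply/orP; left; apply/eqP; ring.
(* The slack is k p^2 + p^2 + (k p)^2 p, whose three terms were shown nonnegative above. *)
apply: le_trans (ler_wpM2l q0 IH2) _; nra.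
Qed.

Theorem lemma1 (R : realType) (k : nat) (hk : (1 <= k)%N) :
  (forall p : R, 0 <= p < 1 ->
     err_prob p (pauli_id k) = F_DD k p 1 /\ F_DD k p 1 = (1 - p) ^+ k) /\
  (forall p pDD : R, 0 <= p < 1 -> 0 <= pDD <= 1 ->
     F_DD k p pDD =
       (1 - p) ^+ k / ((1 - p) ^+ k + pDD * (1 - (1 - p) ^+ k))) /\
  (exists C : R, \forall p \near (0 : R), forall pDD : R,
     0 <= p < 1 -> 0 <= pDD <= 1 ->
     `|F_DD k p pDD - (1 - k%:R * p * pDD)| <= C * p ^+ 2).
Proof.
have F1 (p : R) : F_DD k p 1 = (1 - p) ^+ k.
  by rewrite F_DDE mul1r [_ + (1 - _)]addrC subrK divr1.
split; [|split].
- by move=> p _; rewrite F1 err_prob_id.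
- by move=> p pDD _ _; exact: F_DDE.
(* With x = k p, the 3 is 1 + 2: the two terms of the error are at most x^2 and 2 x^2. *)
exists (3 * k%:R ^+ 2); near=> p => d /andP[p0 p1] /andP[d0 d1].
have k0 : 0 < 2 * (k%:R + 1) :> R by rewrite mulr_gt0 // ltr_wpDl.
have kp : k%:R * p <= 1 / 2.
  have : p < (2 * (k%:R + 1))^-1.
    by near: p; apply: lt_nbhsl; rewrite invr_gt0 mulr_gt0 // ltr_wpDl.
  by rewrite -[_^-1]mul1r ltr_pdivlMr // => ?; nra.
have kp0 : 0 <= k%:R * p by rewrite mulr_ge0.
have /andP[q1 q2] :
    1 - k%:R * p <= (1 - p) ^+ k <= 1 - k%:R * p + (k%:R * p) ^+ 2.
  by apply: exprB1_bounds; rewrite p0 ltW.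
have q3 : (1 - p) ^+ k <= 1.
  by rewrite exprn_ile1 // ?subr_ge0 ?lerBlDr ?lerDl // ltW.
rewrite F_DDE -[leRHS]mulrA -exprMn.
(* Once the power is abstracted, only polynomial inequalities in q, x and d remain. *)
move: ((1 - p) ^+ k) (k%:R * p) q1 q2 q3 kp kp0 => q x q1 q2 q3 x2 x0.
(* Here q + d (1 - q) >= q >= 1 - x >= 1/2. *)
have D2 : 1 / 2 <= q + d * (1 - q) by nra.
have D0 : 0 < q + d * (1 - q) by lra.
have -> : q / (q + d * (1 - q)) - (1 - x * d) =
    d * (x - (1 - q)) - d * (1 - d) * (1 - q) ^+ 2 / (q + d * (1 - q)).
  by field; rewrite gt_eqF.
have s2 : (1 - q) ^+ 2 <= x ^+ 2 by rewrite ler_sqr ?nnegrE; lra.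
have dd : 0 <= d * (1 - d) <= 1 by nra.
have N0 : 0 <= d * (1 - d) * (1 - q) ^+ 2 by rewrite mulr_ge0 ?sqr_ge0; lra.
have t0 : 0 <= d * (1 - d) * (1 - q) ^+ 2 / (q + d * (1 - q)).
  by rewrite divr_ge0 // ltW.
(* The factor 2 is the price of dividing by a denominator that is at least 1/2. *)
have t1 : d * (1 - d) * (1 - q) ^+ 2 / (q + d * (1 - q)) <= 2 * x ^+ 2.
  by rewrite ler_pdivrMr //; nra.
have l0 : 0 <= d * (x - (1 - q)) by rewrite mulr_ge0 //; lra.
have l1 : d * (x - (1 - q)) <= x ^+ 2 by nra.
by rewrite ler_norml; apply/andP; split; lra.
Unshelve. all: by end_near.
Qed.
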